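(* Consider the two-way unsplittable trading problem in the bounded daily return model with parameters $\alpha,\beta>1$, known horizon $T$, and at most $k$ trades. Let \[ t_1 = \frac{\log \beta}{(k+1)\log \beta + k \log \alpha}T,\qquad t_2 = \frac{\log \alpha}{(k+1)\log \beta + k \log \alpha}T, \] each rounded to the nearest integer. Consider the following (static) online algorithm: upon release of the $i$-th price $p(i)$, if $i=T$ and it holds stock, it sells at price $p(T)$; otherwise (if $i<T$), if it has been not holding stock for $t_1$ days (since the start, or since its last sale) and it has not used up all $k$ trades, it buys at price $p(i)$; else if it has been holding stock for $t_2$ days, it sells at price $p(i)$. Then this algorithm has competitive ratio \[ \alpha^{T(2k \log \beta) / ((k+1) \log \beta + k \log \alpha)}. \]
   Context: Bounded daily return model: prices $p(0),p(1),\ldots,p(T)$ (positive reals) are revealed online, one per day, and satisfy $p(i)/\beta\le p(i+1)\le \alpha p(i)$ for all $i$, where $\alpha,\beta>1$; the values $\alpha$, $\beta$ and $T$ are known to the online algorithm in advance. Trades can take place on days $0,1,\ldots,T$. The investor starts with cash and may make at most $k$ trades. A trade is a pair of days $(b,s)$ with $b<s$: on day $b$ all available money is used to buy the stock at price $p(b)$, and on day $s$ all stock is sold at price $p(s)$. Trades cannot overlap (a sale must happen before the next purchase), there is no short selling, no buying on the last day $T$, and any stock held on day $T$ is sold at price $p(T)$. The gain of a trade $(b,s)$ is $p(s)/p(b)$; the return is the product of the gains of the trades made ($1$ if none). OPT is the optimal offline algorithm making at most $k$ trades. The competitive ratio of an online algorithm is the supremum over admissible price sequences of (return of OPT)/(return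 of the algorithm).
   Formalization: With rounded t_1, t_2 the exact formula can fail (α=β, k=1, T=4: ratio at least α^3, not α^{8/3}); proved instead: equality when t_1, t_2 are integers, and for all T, with rounding, equality up to a factor depending only on α, β, k. *)

(* Defs.v *)
From mathcomp Require Import all_boot all_order all_algebra.
From mathcomp Require Import all_classical all_reals all_analysis.
Set Implicit Arguments.
Unset Strict Implicit.
Unset Printing Implicit Defensive.
Import Order.TTheory GRing.Theory Num.Theory.
Local Open Scope classical_set_scope.
Local Open Scope ring_scope.

(* A trade (b, s) buys on day b and sells on day s. *)
Definition trade := (nat * nat)%type.

(* Only the values p 0, ..., p T of the price function are constrained. *)
Definition admissible (R : realType) (alpha beta : R) (T : nat)
    (p : nat -> R) : Prop :=
  (forall i : nat, (i <= T)%N -> 0 < p i) /\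
  (forall i : nat, (i < T)%N -> p i / beta <= p i.+1 <= alpha * p i).

Definition feasible (k T : nat) (tr : seq trade) : bool :=
  [&& (size tr <= k)%N,
      all (fun t => (t.1 < t.2 <= T)%N) tr
    & sorted (fun t u => (t.2 < u.1)%N) tr].

Definition trades_return (R : realType) (p : nat -> R) (tr : seq trade) : R :=
  \prod_(t <- tr) (p t.2 / p t.1).

(* The supremum is a maximum: there are finitely many feasible trade lists. *)
Definition opt_return (R : realType) (k T : nat) (p : nat -> R) : R :=
  sup [set trades_return p tr | tr in [set tr | feasible k T tr]].

(* An algorithm is given by the list of trades it makes on each price
   sequence. *)
Definition competitive_ratio (R : realType) (alpha beta : R) (k T : nat)
    (A : (nat -> R) -> seq trade) : \bar R :=
  ereal_sup [set (opt_return k T p / trades_return p (A p))%:E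
            | p in [set p | admissible alpha beta T p]].

(* [Cash d]: out of the market since day d (the start or the last sale);
   [Stock b]: holding stock bought on day b. *)
Inductive position := Cash of nat | Stock of nat.

Record state := State { pos : position; completed : seq trade }.

(* Reaction to the price of day i. "For t days" is read as "for at least t
   days", which differs from "exactly t" only when t = 0: the algorithm acts
   at most once a day, so the first day on which it can act after a purchase
   or a sale already gives a duration of 1. *)
Definition static_step (k T t1 t2 : nat) (st : state) (i : nat) : state :=
  match pos st with
  | Cash d =>
      if [&& (i < T)%N, (t1 <= i - d)%N & (size (completed st) < k)%N]
      then State (Stock i) (completed st) else st
  | Stock b =>
      if (i == T) || (t2 <= i - b)%N
      then State (Cash i) (rcons (completed st) (b, i)) else st
  end.

Definition static_trades (k T t1 t2 : nat) : seq trade :=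
  completed (foldl (static_step k T t1 t2) (State (Cash 0) [::])
               (iota 0 T.+1)).

(* The algorithm ignores the prices it sees. *)
Definition static_algorithm (R : realType) (k T t1 t2 : nat) :
    (nat -> R) -> seq trade :=
  fun _ => static_trades k T t1 t2.

Definition wait_time (R : realType) (alpha beta : R) (k T : nat) : R :=
  ln beta / (k.+1%:R * ln beta + k%:R * ln alpha) * T%:R.

Definition hold_time (R : realType) (alpha beta : R) (k T : nat) : R :=
  ln alpha / (k.+1%:R * ln beta + k%:R * ln alpha) * T%:R.

(* No tie-breaking convention is imposed on half-integers. *)
Definition nearest_integer (R : realType) (x : R) (n : nat) : Prop :=
  forall m : int, `|x - n%:R| <= `|x - m%:~R|.

Definition ratio_formula (R : realType) (alpha beta : R) (k T : nat) : R :=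
  alpha `^ (T%:R * (2 * k%:R * ln beta)
            / (k.+1%:R * ln beta + k%:R * ln alpha)).

(* Main.v *)
(* Write a = ln alpha, b = ln beta; the log-price moves by a step in [-b, a] each
   day. Away from small T the algorithm alternates k + 1 waiting periods with k
   holding periods. On a given day an offline solution gains at most a on the
   algorithm if it is invested while the algorithm waits, at most b in the
   opposite case, and nothing if both do the same. If it beat the algorithm on
   all 2k + 1 periods it would gain the sum of a t1 per waiting and b t2 per
   holding period, but with only k trades it either misses a whole waiting period
   or stays invested during a whole holding period, so it loses at least one of
   these terms. As a t1 = b t2 up to rounding, the gain is at most 2k a t1 up to a
   constant, and prices rising in waiting and falling in holding periods attain
   it. For bounded T everything is bounded. *)
Require Import Defs.
From mathcomp Require Import all_boot all_order all_algebra.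
From mathcomp Require Import all_classical all_reals all_analysis.
From mathcomp Require Import zify ring lra.
Import Order.TTheory GRing.Theory Num.Theory.
Local Open Scope ring_scope.

(** * The trades made by the static algorithm *)

Definition cyclic_trades (k t1 t2 : nat) : seq trade :=
  [seq (i * (t1 + t2) + t1, i.+1 * (t1 + t2))%N | i <- iota 0 k].

Lemma static_step_wait (k T t1 t2 d : nat) (tr : seq trade) (s : seq nat) :
  (k <= size tr)%N \/ (forall i, i \in s -> (i - d < t1)%N) ->
  foldl (static_step k T t1 t2) (State (Cash d) tr) s = State (Cash d) tr.
Proof.
move=> h; elim: s h => //= i s IHs h.
rewrite [static_step _ _ _ _ (State _ _) _]/static_step /=.
case: ifP => [/and3P[_ h1 h2]|_].
  exfalso; case: h => [h|/(_ i (mem_head _ _)) h]; move: h h1 h2 => /=; lia.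
apply: IHs; case: h => [|h]; [by left|right => j js].
by apply: h; rewrite inE js orbT.
Qed.

Lemma static_step_hold (k T t1 t2 b : nat) (tr : seq trade) (s : seq nat) :
  (forall i, i \in s -> (i - b < t2)%N /\ (i < T)%N) ->
  foldl (static_step k T t1 t2) (State (Stock b) tr) s = State (Stock b) tr.
Proof.
elim: s => //= i s IHs h.
rewrite [static_step _ _ _ _ (State _ _) _]/static_step /=.
case: ifP => [|_]; first by have := h i (mem_head _ _); lia.
by apply: IHs => j js; apply: h; rewrite inE js orbT.
Qed.

Lemma static_step_cycle (k T t1 t2 d : nat) (tr : seq trade) :
  (0 < t1)%N -> (0 < t2)%N -> (size tr < k)%N -> (d + (t1 + t2) <= T)%N ->
  foldl (static_step k T t1 t2) (State (Cash d) tr) (iota d.+1 (t1 + t2)) =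
  State (Cash (d + (t1 + t2))) (rcons tr (d + t1, d + (t1 + t2))%N).
Proof.
(* With both lengths written as successors, the days split into [t1] idle days, the purchase, [t2]
   idle days and the sale. *)
case: t1 t2 => [//|t1] [//|t2] _ _ trk dT.
rewrite -[in iota _ _](addn1 t1) -[in iota _ _](addn1 t2) !iotaD !foldl_cat.
rewrite static_step_wait; last by right => i; rewrite mem_iota; lia.
rewrite /= [static_step _ _ _ _ (State _ _) _]/static_step /= ifT;
  last by apply/and3P; split => //; lia.
rewrite static_step_hold; last by move=> i; rewrite mem_iota; lia.
rewrite /= [static_step _ _ _ _ (State _ _) _]/static_step /= ifT;
  last by apply/orP; right; lia.
by congr (State (Cash _) (rcons _ (_, _))); lia.
Qed.

Lemma static_step_cycles (k T t1 t2 n : nat) :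
  (0 < t1)%N -> (0 < t2)%N -> (n <= k)%N -> (k * (t1 + t2) <= T)%N ->
  foldl (static_step k T t1 t2) (State (Cash 0) [::]) (iota 1 (n * (t1 + t2)))
  = State (Cash (n * (t1 + t2))) (cyclic_trades n t1 t2).
Proof.
move=> t1_gt0 t2_gt0 + kT; elim: n => [//|n IHn] nk.
rewrite mulSn addnC iotaD foldl_cat IHn 1?ltnW// add1n.
rewrite static_step_cycle //; last by nia.
  congr State; rewrite /cyclic_trades -[in RHS]addn1 iotaD map_cat cats1 /=.
  by rewrite add0n mulSn [(t1 + t2 + _)%N]addnC.
by rewrite size_map size_iota.
Qed.

(** Day 0 triggers nothing as [t1] is positive. After [k] full cycles the trades are used up, so the
    rest of the horizon is a last waiting period and the forced sale on day [T] cuts no holding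
    period short. *)
Lemma static_tradesE (k T t1 t2 : nat) :
  (0 < t1)%N -> (0 < t2)%N -> (k * (t1 + t2) <= T)%N ->
  static_trades k T t1 t2 = cyclic_trades k t1 t2.
Proof.
move=> t1_gt0 t2_gt0 kT; rewrite /static_trades.
have -> : iota 0 T.+1 = 0%N :: iota 1 (k * (t1 + t2) + (T - k * (t1 + t2))).
  by rewrite subnKC.
rewrite /= [static_step _ _ _ _ (State _ _) _]/static_step /= ifF; last by lia.
rewrite iotaD foldl_cat static_step_cycles// static_step_wait//.
by left; rewrite size_map size_iota.
Qed.

Definition in_horizon (T : nat) (tr : seq trade) : bool :=
  all (fun t => (t.1 <= T)%N && (t.2 <= T)%N) tr.

Lemma feasible_in_horizon (k T : nat) (tr : seq trade) :
  feasible k T tr -> in_horizon T tr.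
Proof. by case/and3P => _ + _; apply: sub_all => t; lia. Qed.

Lemma static_trades_bounded (k T t1 t2 : nat) :
  (size (static_trades k T t1 t2) <= k)%N /\
  in_horizon T (static_trades k T t1 t2).
Proof.
(* While stock is held, the number of completed trades must be strictly below [k], to leave room for
   the pending sale. *)
pose inv st := (size (completed st) <= k)%N /\
  in_horizon T (completed st) /\
  (if pos st is Stock b then (size (completed st) < k)%N /\ (b <= T)%N
   else True).
have step st i : (i <= T)%N -> inv st -> inv (static_step k T t1 t2 st i).
  case: st => [[d|b] tr] iT; rewrite /inv /static_step /=.
    by case: ifP => [/and3P[_ _ ?]|_] /= [? []].
  case: ifP => //= _ [sz [al [szlt bT]]].
  by rewrite size_rcons /in_horizon all_rcons /= bT iT.
suff : forall s st, {in s, forall i, (i <= T)%N} -> inv st ->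
    inv (foldl (static_step k T t1 t2) st s).
  move=> /(_ (iota 0 T.+1) (State (Cash 0) [::])) [] //.
    by move=> i; rewrite mem_iota.
  by move=> ? [].
elim=> //= i s IHs st h hst; apply: IHs.
  by move=> j js; apply: h; rewrite inE js orbT.
by apply: step => //; apply: h; rewrite mem_head.
Qed.

Lemma cyclic_trades_feasible (k T t1 t2 : nat) :
  (0 < t1)%N -> (0 < t2)%N -> (k * (t1 + t2) <= T)%N ->
  feasible k T (cyclic_trades k t1 t2).
Proof.
move=> t1_gt0 t2_gt0 kT; apply/and3P; split.
- by rewrite size_map size_iota.
- by apply/allP => t /mapP[i]; rewrite mem_iota => ik -> /=; nia.
- rewrite sorted_map; apply: (sub_sorted _ (iota_ltn_sorted 0 k)) => i j /=.
  by nia.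
Qed.

(** The offline answer to the worst case: it is invested in the first [k] waiting periods and misses
    the last one. *)
Definition wait_trades (k t1 t2 : nat) : seq trade :=
  [seq (i * (t1 + t2), i * (t1 + t2) + t1)%N | i <- iota 0 k].

Lemma wait_trades_feasible (k T t1 t2 : nat) :
  (0 < t1)%N -> (0 < t2)%N -> (k * (t1 + t2) <= T)%N ->
  feasible k T (wait_trades k t1 t2).
Proof.
move=> t1_gt0 t2_gt0 kT; apply/and3P; split.
- by rewrite size_map size_iota.
- by apply/allP => t /mapP[i]; rewrite mem_iota => ik -> /=; nia.
- rewrite sorted_map; apply: (sub_sorted _ (iota_ltn_sorted 0 k)) => i j /=.
  by nia.
Qed.

(** * Day-by-day comparison of two trade lists *)

(** The index [j] stands for the price move from day [j] to day [j + 1], so the day of sale is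
    excluded. *)
Definition covered (tr : seq trade) (j : nat) : bool :=
  has (fun t => (t.1 <= j < t.2)%N) tr.

Lemma covered_cyclicP (k t1 t2 j : nat) :
  reflect (exists2 i, (i < k)%N &
             (i * (t1 + t2) + t1 <= j < i.+1 * (t1 + t2))%N)
          (covered (cyclic_trades k t1 t2) j).
Proof.
apply: (iffP hasP) => [[t /mapP[i]]|[i ik ij]].
  by rewrite mem_iota => ik -> /=; exists i.
exists (i * (t1 + t2) + t1, i.+1 * (t1 + t2))%N => //.
by apply/mapP; exists i => //; rewrite mem_iota.
Qed.

Definition log_return {R : realType} (x : nat -> R) (tr : seq trade) : R :=
  \sum_(t <- tr) (x t.2 - x t.1).

Lemma path_trades_after (T : nat) (t : trade) (tr : seq trade) :
  all (fun u => (u.1 < u.2 <= T)%N) tr ->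
  path (fun t u => (t.2 < u.1)%N) t tr -> all (fun u => (t.2 < u.1)%N) tr.
Proof.
elim: tr t => //= u tr IHtr t /andP[uv trv] /andP[tu utr]; rewrite tu /=.
apply: sub_all (IHtr _ trv utr) => v; lia.
Qed.

(** The log-gain of each trade telescopes over its days, and by disjointness no day is counted
    twice. *)
Lemma log_return_covered (R : realType) (x : nat -> R) (k T : nat)
    (tr : seq trade) : feasible k T tr ->
  log_return x tr =
  \sum_(0 <= j < T) (if covered tr j then x j.+1 - x j else 0).
Proof.
case/and3P => _; elim: tr => [|t tr IHtr] /=.
  by move=> _ _; rewrite /log_return big_nil big1.
move=> /andP[tv trv] ttr; rewrite /log_return big_cons -/(log_return _ _).
rewrite IHtr ?(path_sorted ttr)//.
have /allP after := path_trades_after _ _ _ trv ttr.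
rewrite -(telescope_sumr x); last by lia.
rewrite (big_nat_widenl _ 0)// (big_nat_widen _ _ T); last by lia.
rewrite big_mkcond -big_split /=; apply: eq_bigr => j _.
case: ifP => [/andP[h1 h2]|h]; last by rewrite add0r.
rewrite [covered tr j](_ : _ = false) ?addr0//.
by apply/negbTE/hasPn => u utr; have := after u utr; lia.
Qed.

Lemma sum_ge_on_interval (R : realType) (F : nat -> R) (c : R) (T u v : nat) :
  (forall j, 0 <= F j) -> (v <= T)%N ->
  (forall j, (u <= j < v)%N -> c <= F j) ->
  c * (v - u)%:R <= \sum_(0 <= j < T) F j.
Proof.
move=> F0 vT Fc; apply: (@le_trans _ _ (\sum_(u <= j < v) F j)).
  rewrite mulr_natr -sumr_const_nat; apply: ler_sum_nat => j; exact: Fc.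
rewrite (big_nat_widenl _ 0)// (big_nat_widen _ _ T)// big_mkcond /=.
by apply: ler_sum => j _; case: ifP.
Qed.

(* What an offline solution forgoes on a day, compared with the bounds [a] on
   waiting days and [b] on holding days; [H] and [S] tell whether the algorithm
   and the offline solution hold stock. *)
Definition deficiency {R : realType} (a b : R) (H S : bool) : R :=
  if H then (if S then b else 0) else (if S then 0 else a).

(* Pigeonhole: [k] trades either miss one of the [k + 1] waiting periods, or one
   of them meets two waiting periods and hence contains a holding period. *)
Lemma deficiency_ge (R : realType) (a b delta : R) (k T t1 t2 : nat)
    (tr : seq trade) :
  0 <= a -> 0 <= b -> (k * (t1 + t2) <= T)%N -> feasible k T tr ->
  delta <= a * t1%:R -> delta <= a * (T - k * (t1 + t2))%:R ->
  delta <= b * t2%:R ->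
  delta <= \sum_(0 <= j < T)
    deficiency a b (covered (cyclic_trades k t1 t2) j) (covered tr j).
Proof.
move=> a0 b0 kT /and3P[szk _ _] d1 dw d2.
set m := (t1 + t2)%N in kT dw *.
(* The end of waiting period [i]; the last one, [i = k], runs until day [T]. *)
pose e i := if (i < k)%N then (i * m + t1)%N else T.
have D0 j : 0 <= deficiency a b (covered (cyclic_trades k t1 t2) j)
                                  (covered tr j).
  by rewrite /deficiency; do 2 case: ifP.
have [[i missed]|hit] := pselect (exists i : 'I_k.+1,
    forall j, (i * m <= j < e i)%N -> ~~ covered tr j).
  apply: (@le_trans _ _ (a * (e i - i * m)%:R)).
    rewrite /e; case: ifP => ik; first by rewrite addKn.
    by have -> : (i = k :> nat)%N by have := ltn_ord i; lia.
  apply: sum_ge_on_interval => //; first by rewrite /e; case: ifP; nia.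
  move=> j ij; rewrite /deficiency (negbTE (missed j ij)) ifF//.
  apply/negbTE/covered_cyclicP => -[i' i'k]; rewrite -/m => i'j.
  move: ij; rewrite /e; have := ltn_ord i.
  by case: ifP => ik; case: (ltngtP i i'); nia.
(* If no waiting period is missed, choose in each one a covered day and the index of a trade
   covering it. *)
have hit' (i : 'I_k.+1) : {jn : nat * nat |
    (i * m <= jn.1 < e i)%N /\ (jn.2 < size tr)%N /\
    ((nth (0, 0) tr jn.2).1 <= jn.1 < (nth (0, 0) tr jn.2).2)%N}.
  apply: cid; apply: contrapT => nhit; apply: hit; exists i => j ij.
  apply/negP => /hasP[t ttr tj]; apply: nhit; exists (j, index t tr).
  by rewrite /= index_mem nth_index.
pose g (i : 'I_k.+1) : 'I_(size tr) :=
  Ordinal (proj1 (proj2 (svalP (hit' i)))).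
have /injectivePn[i [i' ii' gii']] : ~~ injectiveb g.
  apply/negP => /injectiveP/leq_card; rewrite !card_ord; lia.
wlog lt_ii' : i i' ii' gii' / (i < i')%N.
  move=> wl; case: (ltngtP i i') => [|i'i|/val_inj].
  - exact: wl.
  - by apply: (wl i' i) => //; rewrite eq_sym.
  - by move/eqP; rewrite (negbTE ii').
have [h1 [h2 h3]] := svalP (hit' i).
have [h1' [h2' h3']] := svalP (hit' i').
have egg : (sval (hit' i)).2 = (sval (hit' i')).2 by case: gii'.
rewrite -egg in h2' h3'.
set t := nth _ _ _ in h3 h3'.
have ik : (i < k)%N by have := ltn_ord i'; lia.
have ei : e i = (i * m + t1)%N by rewrite /e ik.
have lt_ei : ((sval (hit' i)).1 < i * m + t1)%N.
  by case/andP: h1 => _ /leq_trans; apply; rewrite ei.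
have le_i' : (i' * m <= (sval (hit' i')).1)%N by case/andP: h1'.
(* The shared trade starts before the end of waiting period [i] and is still open in the later
   period [i'], so it spans the holding period in between. *)
have cov j : (i * m + t1 <= j < i.+1 * m)%N -> covered tr j.
  move=> ij; apply/hasP; exists t; first exact: mem_nth.
  have : ((i.+1) * m <= i' * m)%N by rewrite leq_mul2r lt_ii' orbT.
  move: (sval (hit' i)).1 (sval (hit' i')).1 h3 h3' lt_ei le_i' ij.
  by move=> j1 j2; lia.
apply: (le_trans d2).
have -> : t2%:R = (i.+1 * m - (i * m + t1))%:R :> R.
  by rewrite mulSn addnC subnDl /m addKn.
apply: sum_ge_on_interval => //.
  by apply: leq_trans kT; rewrite leq_mul2r ik orbT.
move=> j ij; rewrite /deficiency (cov _ ij) ifT//.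
by apply/covered_cyclicP; exists i.
Qed.

Definition bounded_steps {R : realType} (a b : R) (T : nat) (x : nat -> R) :
  Prop := forall j, (j < T)%N -> - b <= x j.+1 - x j <= a.

Lemma log_return_const (R : realType) (x : nat -> R) (c : R) (k : nat)
    (f : nat -> trade) :
  (forall i, (i < k)%N -> x (f i).2 - x (f i).1 = c) ->
  log_return x [seq f i | i <- iota 0 k] = c * k%:R.
Proof.
move=> fc; rewrite /log_return big_map mulr_natr.
rewrite -{1}(subn0 k) -/(index_iota 0 k).
by rewrite (eq_big_nat _ _ (F2 := fun=> c)) ?sumr_const_nat ?subn0.
Qed.

(** On each day, the offline advantage plus the deficiency is at most [a] if the algorithm waits and
    [b] if it holds. Summing gives [a * T], corrected by [b - a] on each of the [t2 * k] holding
    days. *)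
Lemma log_ratio_le (R : realType) (a b delta : R) (k T t1 t2 : nat)
    (x : nat -> R) (tr : seq trade) :
  0 <= a -> 0 <= b -> bounded_steps a b T x ->
  (0 < t1)%N -> (0 < t2)%N -> (k * (t1 + t2) <= T)%N -> feasible k T tr ->
  delta <= a * t1%:R -> delta <= a * (T - k * (t1 + t2))%:R ->
  delta <= b * t2%:R ->
  log_return x tr - log_return x (cyclic_trades k t1 t2)
    <= a * T%:R + (b - a) * (t2%:R * k%:R) - delta.
Proof.
move=> a0 b0 xab t1_gt0 t2_gt0 kT ftr d1 dw d2.
have fH := cyclic_trades_feasible k T t1 t2 t1_gt0 t2_gt0 kT.
have := deficiency_ge _ _ _ _ _ _ _ _ _ a0 b0 kT ftr d1 dw d2.
set D := (X in _ <= X) => leD.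
suff : log_return x tr - log_return x (cyclic_trades k t1 t2) + D
    <= a * T%:R + (b - a) * (t2%:R * k%:R) by lra.
(* Holding days are counted as the log-return of the sequence with unit steps, so that
   [log_return_covered] turns every term into a sum over days. *)
have <- : log_return (fun i => i%:R : R) (cyclic_trades k t1 t2) =
    t2%:R * k%:R.
  apply: log_return_const => i _ /=.
  by rewrite mulSn !(natrD, natrM); ring.
rewrite !(log_return_covered _ _ k T)// mulr_natr.
rewrite -[X in a *+ X]subn0 -sumr_const_nat mulr_sumr -sumrB -!big_split /=.
rewrite big_nat_cond [leRHS]big_nat_cond.
apply: ler_sum => j /andP[/andP[_ jT] _].
have /andP[] := xab j jT; rewrite /deficiency -natr1.
by case: covered; case: covered; lra.
Qed.

Lemma bounded_steps_dist (R : realType) (a b : R) (T : nat) (x : nat -> R)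
    (i j : nat) :
  0 <= a -> 0 <= b -> bounded_steps a b T x -> (i <= T)%N -> (j <= T)%N ->
  `|x j - x i| <= T%:R * (a + b).
Proof.
move=> a0 b0 xab; wlog ij : i j / (i <= j)%N.
  move=> wl iT jT; case: (leqP i j) => [|/ltnW] ij; first exact: wl.
  by rewrite distrC; apply: wl.
move=> iT jT; rewrite -(telescope_sumr x ij).
apply: (le_trans (ler_norm_sum _ _ _)).
apply: (@le_trans _ _ (\sum_(i <= l < j) (a + b))).
  rewrite big_nat_cond [leRHS]big_nat_cond.
  apply: ler_sum => l /andP[/andP[_ lj] _].
  by rewrite ler_norml; have /andP[] := xab l (leq_trans lj jT); lra.
by rewrite sumr_const_nat -[leLHS]mulr_natl ler_wpM2r ?ler_nat ?addr_ge0//; lia.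
Qed.

Lemma log_return_dist (R : realType) (a b : R) (k T : nat) (x : nat -> R)
    (tr : seq trade) :
  0 <= a -> 0 <= b -> bounded_steps a b T x ->
  (size tr <= k)%N -> in_horizon T tr ->
  `|log_return x tr| <= k%:R * (T%:R * (a + b)).
Proof.
move=> a0 b0 xab szk trT.
have M0 : 0 <= T%:R * (a + b) by apply: mulr_ge0 => //; lra.
apply: (@le_trans _ _ ((size tr)%:R * (T%:R * (a + b)))); last first.
  by rewrite ler_wpM2r// ler_nat.
elim: tr trT {szk} => [|t tr IHtr] /=.
  by rewrite /log_return big_nil normr0 mul0r.
move=> /andP[/andP[t1T t2T] trT]; rewrite /log_return big_cons.
apply: (le_trans (ler_normD _ _)); rewrite -natr1 mulrDl mul1r addrC lerD//.
  exact: IHtr.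
exact: bounded_steps_dist.
Qed.

(** * From prices to log-prices, and bounds on the competitive ratio *)

Lemma admissible_steps (R : realType) (alpha beta : R) (T : nat)
    (p : nat -> R) :
  1 < alpha -> 1 < beta -> admissible alpha beta T p ->
  bounded_steps (ln alpha) (ln beta) T (fun i => ln (p i)).
Proof.
move=> a1 b1 [p0 pab] j jT.
have alpha0 : 0 < alpha by lra.
have beta0 : 0 < beta by lra.
have pj := p0 j (ltnW jT); have pj1 := p0 j.+1 jT.
have /andP[h1 h2] := pab j jT.
have : ln (p j / beta) <= ln (p j.+1).
  by rewrite ler_ln ?posrE// divr_gt0.
have : ln (p j.+1) <= ln (alpha * p j).
  by rewrite ler_ln ?posrE// mulr_gt0.
by rewrite ln_div ?posrE// lnM ?posrE//; lra.
Qed.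

Lemma trades_returnE (R : realType) (T : nat) (p : nat -> R)
    (tr : seq trade) :
  (forall i, (i <= T)%N -> 0 < p i) -> in_horizon T tr ->
  trades_return p tr = expR (log_return (fun i => ln (p i)) tr).
Proof.
move=> p0 /allP trT; rewrite /trades_return /log_return expR_sum.
apply: eq_big_seq => t /trT/andP[t1T t2T].
by rewrite expRB !lnK// posrE; apply: p0.
Qed.

Lemma le_opt_return (R : realType) (alpha beta : R) (k T : nat)
    (p : nat -> R) (tr : seq trade) :
  1 < alpha -> 1 < beta -> admissible alpha beta T p -> feasible k T tr ->
  trades_return p tr <= opt_return k T p.
Proof.
move=> a1 b1 adm ftr; apply: ub_le_sup; last by exists tr.
(* [sup] is a genuine supremum only on sets bounded above; the crude bound of [log_return_dist]
   supplies the upper bound. *)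
exists (expR (k%:R * (T%:R * (ln alpha + ln beta)))) => _ [u fu <-].
have uT := feasible_in_horizon _ _ _ fu.
rewrite (trades_returnE _ T)//; last by case: adm.
rewrite ler_expR; apply: le_trans (ler_norm _) _.
apply: log_return_dist => //; try exact/ltW/ln_gt0.
  exact: admissible_steps.
by case/and3P: fu.
Qed.

Lemma opt_return_le (R : realType) (k T : nat) (p : nat -> R) (M : R) :
  (forall tr, feasible k T tr -> trades_return p tr <= M) ->
  opt_return k T p <= M.
Proof.
move=> h; apply: ge_sup; last by move=> _ [tr ftr <-]; exact: h.
by exists (trades_return p [::]); exists [::].
Qed.

Lemma competitive_ratio_le (R : realType) (alpha beta : R) (k T : nat)
    (A : (nat -> R) -> seq trade) (B : R) :
  (forall p, in_horizon T (A p)) ->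
  (forall p tr, admissible alpha beta T p -> feasible k T tr ->
     log_return (fun i => ln (p i)) tr - log_return (fun i => ln (p i)) (A p)
       <= B) ->
  (competitive_ratio alpha beta k T A <= (expR B)%:E)%E.
Proof.
move=> AT h; apply: ge_ereal_sup => _ [p adm <-].
have [p0 _] := adm.
rewrite lee_fin [trades_return p (A p)](trades_returnE _ T)//.
rewrite ler_pdivrMr ?expR_gt0//; apply: opt_return_le => tr ftr.
rewrite (trades_returnE _ T) ?(feasible_in_horizon _ _ _ ftr)//.
by rewrite -expRD ler_expR -lerBlDr; apply: h.
Qed.

Lemma competitive_ratio_ge (R : realType) (alpha beta : R) (k T : nat)
    (A : (nat -> R) -> seq trade) (B : R) (p : nat -> R) (tr : seq trade) :
  1 < alpha -> 1 < beta ->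
  in_horizon T (A p) -> admissible alpha beta T p -> feasible k T tr ->
  B <= log_return (fun i => ln (p i)) tr -
       log_return (fun i => ln (p i)) (A p) ->
  ((expR B)%:E <= competitive_ratio alpha beta k T A)%E.
Proof.
move=> a1 b1 AT adm ftr h.
apply: (@le_trans _ _ (opt_return k T p / trades_return p (A p))%:E);
  last first.
  by apply: ereal_sup_ubound; exists p.
have [p0 _] := adm.
rewrite lee_fin [trades_return p (A p)](trades_returnE _ T)//.
rewrite ler_pdivlMr ?expR_gt0//.
apply: le_trans (le_opt_return _ _ _ _ _ _ _ a1 b1 adm ftr).
rewrite (trades_returnE _ T) ?(feasible_in_horizon _ _ _ ftr)//.
by rewrite -expRD ler_expR -lerBrDr.
Qed.

(** [delta] bounds from below the three amounts of which any offline solution forgoes one: a regular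
    waiting period, the last one, whose length depends on rounding, or a holding period. *)
Lemma static_ratio_le (R : realType) (alpha beta delta : R)
    (k T t1 t2 : nat) :
  1 < alpha -> 1 < beta ->
  (0 < t1)%N -> (0 < t2)%N -> (k * (t1 + t2) <= T)%N ->
  delta <= ln alpha * t1%:R ->
  delta <= ln alpha * (T - k * (t1 + t2))%:R ->
  delta <= ln beta * t2%:R ->
  (competitive_ratio alpha beta k T (@static_algorithm R k T t1 t2) <=
   (expR (ln alpha * T%:R + (ln beta - ln alpha) * (t2%:R * k%:R)
          - delta))%:E)%E.
Proof.
move=> a1 b1 t1_gt0 t2_gt0 kT d1 dw d2; apply: competitive_ratio_le => [p|].
  by case: (static_trades_bounded k T t1 t2).
move=> p tr adm ftr; rewrite /static_algorithm static_tradesE//.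
apply: log_ratio_le => //; try exact/ltW/ln_gt0.
exact: admissible_steps.
Qed.

(* The worst case prices rise while the algorithm waits and fall while it
   holds. *)
Lemma static_ratio_ge (R : realType) (alpha beta : R) (k T t1 t2 : nat) :
  1 < alpha -> 1 < beta ->
  (0 < t1)%N -> (0 < t2)%N -> (k * (t1 + t2) <= T)%N ->
  ((expR (ln alpha * t1%:R * k%:R + ln beta * t2%:R * k%:R))%:E <=
   competitive_ratio alpha beta k T (@static_algorithm R k T t1 t2))%E.
Proof.
move=> a1 b1 t1_gt0 t2_gt0 kT.
pose H := covered (cyclic_trades k t1 t2).
pose x j : R := \sum_(0 <= i < j) (if H i then - ln beta else ln alpha).
have xS j : x j.+1 = x j + (if H j then - ln beta else ln alpha).
  by rewrite /x big_nat_recr.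
have xconst c i n : (forall j, (i <= j < i + n)%N ->
    (if H j then - ln beta else ln alpha) = c) -> x (i + n)%N - x i = c * n%:R.
  elim: n => [|n IHn] h; first by rewrite addn0 subrr mulr0.
  rewrite addnS xS h; last by lia.
  rewrite addrAC IHn; last by move=> j ij; apply: h; lia.
  by rewrite -natr1 mulrDr mulr1.
have alpha0 : 0 < alpha by lra.
have beta0 : 0 < beta by lra.
have la := ln_gt0 a1; have lb := ln_gt0 b1.
have lnx : (fun i => ln (expR (x i))) = x by apply/funext => i; rewrite expRK.
apply: (@competitive_ratio_ge _ _ _ _ _ _ _ (fun i => expR (x i))
         (wait_trades k t1 t2)) => //.
- by case: (static_trades_bounded k T t1 t2).
- split=> [i _|i _]; first exact: expR_gt0.
  rewrite -{1}(lnK (x := beta)) ?posrE// -{1}(lnK (x := alpha)) ?posrE//.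
  by rewrite -expRB -expRD !ler_expR xS; case: (H i); lra.
- exact: wait_trades_feasible.
rewrite lnx /static_algorithm static_tradesE//.
rewrite (log_return_const _ _ (ln alpha * t1%:R)); last first.
  move=> i ik /=; apply: xconst => j ij; rewrite ifF//.
  apply/negbTE/covered_cyclicP => -[i' i'k].
  by case: (ltngtP i i'); nia.
rewrite (log_return_const _ _ (- ln beta * t2%:R)); last first.
  move=> i ik /=; rewrite mulSn addnC addnA; apply: xconst => j ij.
  by rewrite ifT//; apply/covered_cyclicP; exists i => //; nia.
lra.
Qed.

(** Meant for bounded [T], where rounding may make a period vanish. Constant prices give the lower
    bound; the upper one adds the crude bounds for the offline solution and the algorithm. *)
Lemma static_ratio_crude (R : realType) (alpha beta : R) (k T t1 t2 : nat) :
  1 < alpha -> 1 < beta ->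
  ((expR 0)%:E <=
   competitive_ratio alpha beta k T (@static_algorithm R k T t1 t2) <=
   (expR (2 * (k%:R * (T%:R * (ln alpha + ln beta)))))%:E)%E.
Proof.
move=> a1 b1; have [szA AT] := static_trades_bounded k T t1 t2.
have la := ln_gt0 a1; have lb := ln_gt0 b1.
apply/andP; split.
  apply: (@competitive_ratio_ge _ _ _ _ _ _ _ (fun=> 1) [::]) => //.
    split=> i _ //; apply/andP; split; last by lra.
    by rewrite div1r invf_le1 ?ltW//; lra.
  rewrite /log_return big_nil big1 ?subrr// => t _; exact: subrr.
apply: competitive_ratio_le => // p tr adm ftr.
have xab := admissible_steps _ _ _ _ _ a1 b1 adm.
have [sztr _ _] := and3P ftr.
have := log_return_dist _ _ _ _ _ _ _ (ltW la) (ltW lb) xab szA AT.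
have := log_return_dist _ _ _ _ _ _ _ (ltW la) (ltW lb) xab sztr
          (feasible_in_horizon _ _ _ ftr).
by rewrite !ler_norml /static_algorithm; lra.
Qed.

(** * Rounding, and the exact and asymptotic ratio *)

Lemma nearest_integer_dist (R : realType) (x : R) (n : nat) :
  nearest_integer x n -> `|x - n%:R| <= 1.
Proof.
move=> /(_ (Num.floor x)) /le_trans; apply; rewrite ger0_norm.
  by rewrite lerBlDl -intrD1; apply/ltW/floorD1_gt.
by rewrite subr_ge0 floor_le.
Qed.

Lemma wait_hold_times (R : realType) (alpha beta : R) (k T : nat)
    (w := wait_time alpha beta k T) (h := hold_time alpha beta k T) :
  1 < alpha -> 1 < beta ->
  [/\ 0 <= w, 0 <= h, ln alpha * w = ln beta * h
    & w + k%:R * (w + h) = T%:R].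
Proof.
move=> a1 b1; have la := ln_gt0 a1; have lb := ln_gt0 b1.
have D_gt0 : 0 < k.+1%:R * ln beta + k%:R * ln alpha.
  by rewrite ltr_pwDl ?mulr_gt0 ?mulr_ge0 ?ltr0n// ltW.
rewrite /w /h /wait_time /hold_time; split.
- by rewrite !mulr_ge0 ?invr_ge0// ltW.
- by rewrite !mulr_ge0 ?invr_ge0// ltW.
- by ring.
- by move: D_gt0; rewrite -natr1 => /lt0r_neq0 D0; field.
Qed.

Lemma ratio_formulaE (R : realType) (alpha beta : R) (k T : nat) :
  1 < alpha ->
  ratio_formula alpha beta k T =
  expR (2 * k%:R * (ln alpha * wait_time alpha beta k T)).
Proof.
move=> a1; rewrite /ratio_formula /powR gt_eqF; last by lra.
by congr expR; rewrite /wait_time; ring.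
Qed.

(** Rounding shifts the log of the ratio by a bounded amount, hence the factor [C], which is chosen
    before [T]; when both times are integers the ratio is exact. *)
Theorem theorem7 (R : realType) (alpha beta : R) (k : nat)
    (halpha : 1 < alpha) (hbeta : 1 < beta) :
  (forall T t1 t2 : nat,
     wait_time alpha beta k T = t1%:R ->
     hold_time alpha beta k T = t2%:R ->
     competitive_ratio alpha beta k T (@static_algorithm R k T t1 t2)
     = (ratio_formula alpha beta k T)%:E)
  /\
  (exists2 C : R, 0 < C &
     forall T t1 t2 : nat,
     nearest_integer (wait_time alpha beta k T) t1 ->
     nearest_integer (hold_time alpha beta k T) t2 ->
     ((C^-1 * ratio_formula alpha beta k T)%:E
        <= competitive_ratio alpha beta k T (@static_algorithm R k T t1 t2)
        <= (C * ratio_formula alpha beta k T)%:E)%E).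
Proof.
have la := ln_gt0 halpha; have lb := ln_gt0 hbeta.
set a := ln alpha in la; set b := ln beta in lb.
have k0 : 0 <= k%:R :> R by [].
have ka0 : 0 <= k%:R * a by rewrite mulr_ge0// ltW.
have kb0 : 0 <= k%:R * b by rewrite mulr_ge0// ltW.
pose D := k.+1%:R * b + k%:R * a.
have D_gt0 : 0 < D by rewrite /D -natr1; lra.
split=> [T t1 t2 wE hE|].
  have [_ _] := wait_hold_times _ alpha beta k T halpha hbeta.
  rewrite ratio_formulaE// wE hE -/a -/b => ab TE.
  have {TE} TE : (T = t1 + k * (t1 + t2))%N.
    by apply/eqP; rewrite -(eqr_nat R) natrD natrM natrD TE.
  (* For [T = 0] both periods are empty and the crude bounds already force ratio 1. *)
  case: (posnP T) => [T0|T_gt0].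
    have t10 : t1 = 0%N by lia.
    have /andP[lo hi] := static_ratio_crude _ alpha beta k T t1 t2 halpha hbeta.
    apply/le_anti/andP; split.
      apply: (le_trans hi).
      by rewrite lee_fin ler_expR T0 t10 !(mul0r, mulr0).
    by apply: le_trans lo; rewrite lee_fin ler_expR t10 !mulr0.
  have t1_gt0 : (0 < t1)%N.
    rewrite lt0n; apply/eqP => t10; move: wE.
    rewrite t10 /wait_time -/a -/b -/D.
    by apply/eqP; rewrite !mulf_neq0 ?pnatr_eq0 -?lt0n ?gt_eqF// invr_gt0.
  have t2_gt0 : (0 < t2)%N.
    rewrite lt0n; apply/eqP => t20; move: hE.
    rewrite t20 /hold_time -/a -/b -/D.
    by apply/eqP; rewrite !mulf_neq0 ?pnatr_eq0 -?lt0n ?gt_eqF// invr_gt0.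
  have kT : (k * (t1 + t2) <= T)%N by rewrite TE leq_addl.
  apply/le_anti/andP; split.
    (* Without rounding the last waiting period also has length [t1], and all three forgone amounts
       equal [a * t1]. *)
    have := static_ratio_le _ alpha beta (a * t1%:R) k T t1 t2 halpha hbeta
      t1_gt0 t2_gt0 kT.
    have -> : (T - k * (t1 + t2) = t1)%N by rewrite TE addnK.
    rewrite -/a -/b -ab => /(_ (lexx _) (lexx _) (lexx _)).
    congr (_ <= (expR _)%:E)%E; rewrite TE natrD natrM natrD.
    have -> : (b - a) * (t2%:R * k%:R) =
      (b * t2%:R - a * t2%:R) * k%:R by ring.
    by rewrite -ab; ring.
  have := static_ratio_ge _ alpha beta k T t1 t2 halpha hbeta t1_gt0 t2_gt0 kT.
  by rewrite -/a -/b -ab; congr ((expR _)%:E <= _)%E; ring.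
(* [M] bounds [T] when a time is below its threshold, [2k + 2] for waiting or 2 for holding, since
   [T] is [D / b] times the former and [D / a] times the latter. The last term of [K] serves this
   case; the others absorb rounding errors, with room to spare. *)
pose M := (2 * k%:R + 2) * (D / b + D / a).
pose K := 5 * (k%:R * a) + 5 * (k%:R * b) + a + b + 2 * (k%:R * (M * (a + b))).
have M0 : 0 <= M.
  by rewrite mulr_ge0 ?addr_ge0 ?mulr_ge0 ?invr_ge0// ltW.
have kM0 : 0 <= k%:R * (M * (a + b)).
  by rewrite mulr_ge0// mulr_ge0// addr_ge0// ltW.
exists (expR K); first exact: expR_gt0.
move=> T t1 t2 /nearest_integer_dist + /nearest_integer_dist.
rewrite ratio_formulaE// -expRN -!expRD -/a.
have [] := wait_hold_times _ alpha beta k T halpha hbeta.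
have wDE : wait_time alpha beta k T * D = b * T%:R.
  by rewrite /wait_time -/a -/b -/D; field; rewrite gt_eqF.
have hDE : hold_time alpha beta k T * D = a * T%:R.
  by rewrite /hold_time -/a -/b -/D; field; rewrite gt_eqF.
move: wDE hDE; set w := wait_time _ _ _ _; set h := hold_time _ _ _ _.
rewrite -/a -/b => wDE hDE w0 h0 ab TE; rewrite !ler_norml.
move=> /andP[w1 w2] /andP[h1 h2].
have kh0 : 0 <= k%:R * (w + h) by rewrite mulr_ge0 ?addr_ge0.
(* Rounding lengthens the [k] cycles by at most [2k] days in total, which the last waiting period
   can absorb; the extra slack keeps [t1] and [t2] positive. *)
have [/andP[w_large h_large]|small] := boolP ((2 * k%:R + 2 <= w) && (2 <= h)).
  have t1_gt0 : (0 < t1)%N by rewrite -(ltr0n R); lra.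
  have t2_gt0 : (0 < t2)%N by rewrite -(ltr0n R); lra.
  have kt1 : k%:R * (w - 1) <= k%:R * t1%:R <= k%:R * (w + 1).
    by rewrite !ler_wpM2l//; lra.
  have kt2 : k%:R * (h - 1) <= k%:R * t2%:R <= k%:R * (h + 1).
    by rewrite !ler_wpM2l//; lra.
  have kT : (k * (t1 + t2) <= T)%N.
    by rewrite -(ler_nat R) natrM natrD -TE; lra.
  have restE : (T - k * (t1 + t2))%:R =
      T%:R - (k%:R * t1%:R + k%:R * t2%:R) :> R.
    by rewrite natrB// natrM natrD mulrDr.
  have akt1 : a * (k%:R * (w - 1)) <= a * (k%:R * t1%:R).
    by rewrite ler_wpM2l ?(ltW la) ?(ltW lb)//; case/andP: kt1.
  have bkt2 :
      b * (k%:R * (h - 1)) <= b * (k%:R * t2%:R) <= b * (k%:R * (h + 1)).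
    by rewrite !ler_wpM2l ?(ltW la) ?(ltW lb)//; lra.
  have akt2 : a * (k%:R * (h - 1)) <= a * (k%:R * t2%:R).
    by rewrite ler_wpM2l ?(ltW la) ?(ltW lb)//; case/andP: kt2.
  have kab : k%:R * (a * w) = k%:R * (b * h) by rewrite ab.
  apply/andP; split.
    apply: le_trans (static_ratio_ge _ alpha beta k T t1 t2 halpha hbeta
      t1_gt0 t2_gt0 kT).
    by rewrite lee_fin ler_expR -/a -/b /K; lra.
  (* Each forgone amount is [a * w = b * h] before rounding, which lowers it by at most [a], [b] or
     [2 * k * a]; subtracting all three gives a common [delta]. *)
  have d1 : a * w - (2 * (k%:R * a) + a + b) <= a * t1%:R.
    have : a * (w - 1) <= a * t1%:R by rewrite ler_wpM2l ?(ltW la)//; lra.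
    lra.
  have d2 : a * w - (2 * (k%:R * a) + a + b) <= b * t2%:R.
    have : b * (h - 1) <= b * t2%:R by rewrite ler_wpM2l ?(ltW lb)//; lra.
    lra.
  have dw : a * w - (2 * (k%:R * a) + a + b) <= a * (T - k * (t1 + t2))%:R.
    have : a * (w - 2 * k%:R) <= a * (T - k * (t1 + t2))%:R.
      by rewrite ler_wpM2l ?(ltW la) ?(ltW lb)// restE -TE; lra.
    lra.
  apply: le_trans (static_ratio_le _ alpha beta _ k T t1 t2 halpha hbeta
      t1_gt0 t2_gt0 kT d1 dw d2) _.
  by rewrite lee_fin ler_expR -/a -/b /K -TE; lra.
have TM : T%:R <= M.
  have Db0 : 0 <= D / b by rewrite divr_ge0 ?ltW.
  have Da0 : 0 <= D / a by rewrite divr_ge0 ?ltW.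
  have kDb0 : 0 <= k%:R * (D / b) by rewrite mulr_ge0.
  have kDa0 : 0 <= k%:R * (D / a) by rewrite mulr_ge0.
  move: small; rewrite negb_and -!ltNge => /orP[] lt.
    have -> : T%:R = w * (D / b).
      by rewrite mulrA wDE mulrC mulKf// gt_eqF.
    by have := ler_wpM2r Db0 (ltW lt); rewrite /M; lra.
  have -> : T%:R = h * (D / a).
    by rewrite mulrA hDE mulrC mulKf// gt_eqF.
  by have := ler_wpM2r Da0 (ltW lt); rewrite /M; lra.
have kTM : k%:R * (T%:R * (a + b)) <= k%:R * (M * (a + b)).
  by rewrite ler_wpM2l// ler_wpM2r// addr_ge0 ?ltW.
(* As [w <= T], the exponent of the claimed ratio is bounded too, so both sides agree up to
   [expR K]. *)
have kaw0 : 0 <= k%:R * (a * w) by rewrite mulr_ge0// mulr_ge0// ltW.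
have kawT : k%:R * (a * w) <= k%:R * (T%:R * (a + b)).
  by rewrite ler_wpM2l// mulrC ler_pM ?(ltW la)//; lra.
have /andP[lo hi] := static_ratio_crude _ alpha beta k T t1 t2 halpha hbeta.
apply/andP; split.
  by apply: le_trans lo; rewrite lee_fin ler_expR /K; lra.
by apply: (le_trans hi); rewrite lee_fin ler_expR -/a -/b /K; lra.
Qed.
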